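(* Let $\Gamma$ be a finite graph which is a Cayley graph, or a Cayley sum graph, or a twisted Cayley graph, or a twisted Cayley sum graph, or a vertex-transitive graph, of degree $d$. Assume $\Gamma$ is undirected and non-bipartite. Then $\mathfrak h_{\Gamma^2}>\frac{\mathfrak h_\Gamma^2}{48\,d}$.
   Context: Graphs may have loops and multiple edges; a graph on a finite vertex set $V$ ($|V|\ge2$) is encoded by its adjacency matrix $M:V\times V\to\mathbb{Z}_{\ge0}$; undirected means $M$ symmetric; degree $d$ means all row sums equal $d$. Non-bipartite: no partition $V=V_1\sqcup V_2$ with $M(x,y)=0$ whenever $x,y$ are in the same part. For $A,B\subseteq V$ let $e_M(A,B)=\sum_{a\in A,b\in B}M(a,b)$. The edge Cheeger constant of a $D$-regular graph with adjacency matrix $M$ is $\min\{e_M(F,V\setminus F)/(D|F|):\emptyset\ne F\subseteq V,|F|\le|V|/2\}$. $\mathfrak h_\Gamma$ is the edge Cheeger constant of $\Gamma$ (with $D=d$), and $\Gamma^2$ denotes the $d^2$-regular multigraph on $V$ with adjacency matrix $M^2$, so $\mathfrak h_{\Gamma^2}$ is computed with $D=d^2$. For a finite group $G$, $S\subseteq G$ and automorphism $\sigma$ of $G$: the twisted Cayley graph $C(G,S)^\sigma$ has vertex set $G$ with $y$ adjacent to $x$ iff $y=\sigma(xs)$ for some $s\in S$; the twisted Cayley sum graph $C_\Sigma(G,S)^\sigma$ has $y$ adjacent to $x$ iff $y=\sigma(x^{-1}s)$ for some $s\in S$; Cayley graphs and Cayley sum graphs are the cases $\sigma=\mathrm{i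d}$.
   Formalization: The graph Γ is additionally assumed connected; for disconnected Γ (e.g. two disjoint triangles) both Cheeger constants are 0 and the strict inequality fails. *)

(* Defs.v *)
From HB Require Import structures.
From mathcomp Require Import all_boot all_order all_algebra all_fingroup.

Set Implicit Arguments.
Unset Strict Implicit.
Unset Printing Implicit Defensive.

Import Order.TTheory GRing.Theory Num.Theory.
Local Open Scope ring_scope.

(* [M x y] is the number of edges from [x] to [y]. *)
Definition adjacency (V : finType) := V -> V -> nat.

Section Graphs.
Variable V : finType.
Implicit Types (M : adjacency V) (A B F : {set V}) (D : nat).

Definition undirected M : Prop := forall x y, M x y = M y x.

Definition regular M D : Prop := forall x, (\sum_y M x y)%N = D.

(* The parts are [A] and its complement; on two or more vertices, allowing an
   empty part changes nothing. *)
Definition bipartite M : Prop :=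
  exists A, forall x y, (x \in A) = (y \in A) -> M x y = 0%N.

(* A disconnected graph such as two disjoint triangles can be an undirected
   non-bipartite Cayley graph, but then both Cheeger constants vanish and a
   strict inequality between them fails. *)
Definition connected M : Prop :=
  forall x y, connect [rel u v | (0 < M u v)%N] x y.

Definition vertex_transitive M : Prop :=
  forall x y, exists s : {perm V},
    (forall u v, M (s u) (s v) = M u v) /\ s x = y.

Definition square M : adjacency V := fun x y => (\sum_z M x z * M z y)%N.

Definition edges M A B : nat := (\sum_(a in A) \sum_(b in B) M a b)%N.

Definition cheeger_admissible : pred {set V} :=
  [pred F | (F != set0) && (2 * #|F| <= #|V|)%N].

Definition cheeger_ratio M D F : rat :=
  (edges M F (~: F))%:R / (D%:R * #|F|%:R).

(* Seeding the fold with the first ratio makes it the true minimum of the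
   finite nonempty family of ratios, see [cheegerP]. *)
Definition cheeger M D : rat :=
  let s := [seq cheeger_ratio M D F | F in cheeger_admissible] in
  \big[Num.min/head 0 s]_(r <- s) r.

Lemma cheegerP M D : (1 < #|V|)%N ->
  (exists2 F, cheeger_admissible F & cheeger M D = cheeger_ratio M D F) /\
  (forall F, cheeger_admissible F -> cheeger M D <= cheeger_ratio M D F).
Proof.
move=> V_gt1; rewrite /cheeger.
set s := [seq _ | F in _].
have mem_s F : cheeger_admissible F -> cheeger_ratio M D F \in s.
  by move=> admF; apply: image_f.
have [x _] : exists x : V, x \in V by apply/card_gt0P; apply: ltnW.
have admx : cheeger_admissible [set x].
  by rewrite /cheeger_admissible /= cards1 -card_gt0 cards1.
have s_head : head 0 s \in s.
  by move: (mem_s _ admx); clear mem_s; case: s => //= r s' _; rewrite mem_head.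
split=> [|F admF]; last first.
  move: (mem_s F admF); clear mem_s s_head; elim: s (head 0 s) => //= r s IHs r0.
  rewrite inE big_cons ge_min => /predU1P[->|/IHs->]; first by rewrite lexx.
  by rewrite orbT.
suff /imageP[F admF ->] : \big[Num.min/head 0 s]_(r <- s) r \in s by exists F.
rewrite big_seq; elim/big_ind: _ => // u v us vs.
by rewrite minEle; case: ifP.
Qed.

End Graphs.

Section CayleyAdjacency.
Local Open Scope group_scope.
Variables (gT : finGroupType) (S : {set gT}) (sigma : {perm gT}).

(* The boolean adjacency is coerced to [nat]: these graphs have no multiple
   edges. *)
Definition twisted_cayley_adj : adjacency gT :=
  fun x y => [exists s in S, y == sigma (x * s)].

Definition twisted_cayley_sum_adj : adjacency gT :=
  fun x y => [exists s in S, y == sigma (x^-1 * s)].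

End CayleyAdjacency.

Definition graph_iso (V W : finType) (M : adjacency V) (N : adjacency W) : Prop :=
  exists2 f : V -> W, bijective f & forall x y, M x y = N (f x) (f y).

Section CayleyClasses.
Variables (V : finType) (M : adjacency V).

Definition is_twisted_cayley_graph : Prop :=
  exists (gT : finGroupType) (S : {set gT}) (sigma : {perm gT}),
    sigma \in Aut [set: gT] /\ graph_iso M (twisted_cayley_adj S sigma).

Definition is_twisted_cayley_sum_graph : Prop :=
  exists (gT : finGroupType) (S : {set gT}) (sigma : {perm gT}),
    sigma \in Aut [set: gT] /\ graph_iso M (twisted_cayley_sum_adj S sigma).

Definition is_cayley_graph : Prop :=
  exists (gT : finGroupType) (S : {set gT}),
    graph_iso M (twisted_cayley_adj S 1%g).

Definition is_cayley_sum_graph : Prop :=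
  exists (gT : finGroupType) (S : {set gT}),
    graph_iso M (twisted_cayley_sum_adj S 1%g).

End CayleyClasses.

(* Main.v *)
Require Import Defs.
From HB Require Import structures.
From mathcomp Require Import all_boot all_order all_algebra all_fingroup.
From mathcomp Require Import zify lra.

(* Left and right translations make every graph in these classes transitive
   under pairs of permutations [(p, q)] with [M (p u) (q v) = M u v]; this
   property is all that is used. Suppose the bound fails for a minimizer [F] of
   the ratio of the square, and let [B] be the set of vertices with most of
   their neighbours in [F]. Then all but a fraction [h ^ 2 / 24] of [#|F|] edges
   join [F] to [B] or avoid both, while [F] and [B] are almost complementary.
   Isoperimetry forces each translate of the pair [(F, B)] to be close either to
   [(F, B)] or to the pair of complements, and the choice is a homomorphism
   [c] to [bool]. A majority vote over all translates replaces [F] and [B] by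
   nearby sets [A'] and [B'] that are translated exactly according to [c].
   The number of edges violating [x \in A' <-> y \in B'] is then a multiple of
   [#|V|] and less than [#|V|], so it vanishes; by connectedness [B'] is the
   complement of [A'], and the graph is bipartite. *)

Set Implicit Arguments.
Unset Strict Implicit.
Unset Printing Implicit Defensive.

Import Order.TTheory GRing.Theory Num.Theory.
Local Open Scope ring_scope.

(** * Two-fold automorphisms, and transitivity of the five graph classes *)

Definition tf_automorphism (V : finType) (M : adjacency V)
    (g : {perm V} * {perm V}) : bool :=
  [forall u, forall v, M (g.1 u) (g.2 v) == M u v].

Definition tf_transitive (V : finType) (M : adjacency V) : Prop :=
  forall x y, exists2 g : {perm V} * {perm V}, tf_automorphism M g & g.1 x = y.

Lemma tf_automorphismP (V : finType) (M : adjacency V) (g : {perm V} * {perm V}) :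
  reflect (forall u v, M (g.1 u) (g.2 v) = M u v) (tf_automorphism M g).
Proof.
apply: (iffP forallP) => [tf u v | tf u]; first by have /forallP/(_ v)/eqP := tf u.
by apply/forallP=> v; apply/eqP.
Qed.

Lemma tf_automorphismM (V : finType) (M : adjacency V) (g k : {perm V} * {perm V}) :
  tf_automorphism M g -> tf_automorphism M k -> tf_automorphism M (g * k)%g.
Proof.
move=> /tf_automorphismP tfg /tf_automorphismP tfk; apply/tf_automorphismP=> u v.
by rewrite /= !permM tfk tfg.
Qed.

Lemma tf_automorphism_swap (V : finType) (M : adjacency V) (g : {perm V} * {perm V}) :
  undirected M -> tf_automorphism M g -> tf_automorphism M (g.2, g.1).
Proof.
move=> symM /tf_automorphismP tfg; apply/tf_automorphismP=> u v /=.
by rewrite symM tfg symM.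
Qed.

Lemma graph_iso_tf_transitive (V W : finType) (M : adjacency V) (N : adjacency W) :
  graph_iso M N -> tf_transitive N -> tf_transitive M.
Proof.
case=> f [f' fK f'K] MN trN x y.
have [g /tf_automorphismP tfg gxy] := trN (f x) (f y).
have inj (s : {perm W}) : injective (f' \o s \o f).
  by move=> u v /= /(can_inj f'K) /perm_inj /(can_inj fK).
exists (perm (inj g.1), perm (inj g.2)); last by rewrite /= permE /= gxy fK.
by apply/tf_automorphismP=> u v; rewrite /= !permE /= !MN !f'K tfg.
Qed.

Lemma vertex_transitive_tf_transitive (V : finType) (M : adjacency V) :
  vertex_transitive M -> tf_transitive M.
Proof.
by move=> trM x y; have [s [Ms sx]] := trM x y; exists (s, s) => //; apply/tf_automorphismP.
Qed.

Lemma twisted_cayley_tf_transitive (gT : finGroupType) (S : {set gT})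
    (sigma : {perm gT}) :
  sigma \in Aut [set: gT] -> tf_transitive (twisted_cayley_adj S sigma).
Proof.
move=> sigmaA x y; have /morphicP sM := Aut_morphic sigmaA.
(* Left translation by [t] sends [sigma (u * s)] to [sigma t * sigma (u * s)], so the second
   component is left translation by [sigma t]. *)
exists (perm (mulgI (y * x^-1)%g), perm (mulgI (sigma (y * x^-1)%g))).
  apply/tf_automorphismP=> u v; rewrite /= !permE /twisted_cayley_adj.
  congr (nat_of_bool _); apply: eq_existsb => s.
  by rewrite -mulgA [sigma (_ * (u * s))%g]sM ?inE // (inj_eq (mulgI _)).
by rewrite /= permE mulgKV.
Qed.

Lemma twisted_cayley_sum_tf_transitive (gT : finGroupType) (S : {set gT})
    (sigma : {perm gT}) :
  sigma \in Aut [set: gT] -> tf_transitive (twisted_cayley_sum_adj S sigma).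
Proof.
move=> sigmaA x y; have /morphicP sM := Aut_morphic sigmaA.
(* Inversion turns right translation of [u] by [t] into left translation of [u^-1] by [t^-1], hence
   the different sides of the two components. *)
exists (perm (mulIg (x^-1 * y)%g), perm (mulgI (sigma (x^-1 * y)^-1%g))).
  apply/tf_automorphismP=> u v; rewrite /= !permE /twisted_cayley_sum_adj.
  congr (nat_of_bool _); apply: eq_existsb => s.
  by rewrite [((u * _)^-1)%g]invMg -mulgA [sigma (_ * (u^-1 * s))%g]sM ?inE // (inj_eq (mulgI _)).
by rewrite /= permE mulKVg.
Qed.

Lemma card_sum_nat (T : finType) (P : pred T) : #|[set x | P x]| = (\sum_x P x)%N.
Proof.
rewrite -sum1_card big_mkcond /=; apply: eq_bigr => x _.
by rewrite inE; case: (P x).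
Qed.

Lemma card_preim_perm (T : finType) (s : {perm T}) (P : pred T) :
  #|[set x | P (s x)]| = #|[set x | P x]|.
Proof. by rewrite !card_sum_nat [RHS](reindex_inj (@perm_inj _ s)). Qed.

(** * Majority vote over a transitive family of near-symmetries *)

Section Majority.
Variables (V : finType) (G : finGroupType) (T : {set G}).
Variables (f : G -> {perm V}) (c : G -> bool) (F : {set V}) (m : nat).
Hypothesis fM : forall g k, f (g * k)%g = (f g * f k)%g.
Hypothesis TM : forall g k, g \in T -> k \in T -> (g * k)%g \in T.
Hypothesis cM : forall g k, g \in T -> k \in T -> c (g * k)%g = c g (+) c k.
Hypothesis trT : forall x y, exists2 g, g \in T & f g x = y.
Hypothesis nearF : forall g, g \in T ->
  (#|[set x | (f g x \in F) != (x \in F) (+) c g]| <= m)%N.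

Let vote (b : bool) x := #|[set g in T | (f g x \in F) (+) c g == b]|.

Lemma vote_total x : (vote true x + vote false x = #|T|)%N.
Proof.
rewrite /vote -(cardsID [set g | (f g x \in F) (+) c g == true] T).
by congr addn; apply: eq_card => g; rewrite !inE; case: (_ (+) _); case: (g \in T).
Qed.

(** Left multiplication by [k] permutes the finite closed set [T], and the voter [g] at [f k x] is
    the voter [k * g] at [x], up to the flip [c k]. *)
Lemma vote_act b k x : k \in T -> vote b (f k x) = vote (b (+) c k) x.
Proof.
move=> kT; rewrite /vote.
have kI : injective (mulg k) by apply: mulgI.
have kTE : (mulg k) @: T = T.
  apply/eqP; rewrite eqEcard card_imset // leqnn andbT.
  by apply/subsetP=> _ /imsetP[g gT ->]; apply: TM.
rewrite -(card_imset _ kI); apply: eq_card => h; apply/imsetP/idP => [[g] | ].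
  rewrite !inE => /andP[gT /eqP <-] ->; rewrite TM //= cM // fM permM.
  by case: (_ \in F); case: (c k); case: (c g).
rewrite inE => /andP[hT vh].
have /imsetP[g gT hE] : h \in (mulg k) @: T by rewrite kTE.
exists g => //; rewrite inE gT /=; move: vh; rewrite hE cM // fM permM.
by case: (_ \in F); case: (c k); case: (c g); case: b.
Qed.

(** Double counting of the pairs [(x, g)] in which [g] votes at [x] against [F]. *)
Lemma sum_minority : (\sum_x vote (x \notin F) x <= #|T| * m)%N.
Proof.
have -> : (\sum_x vote (x \notin F) x =
    \sum_(g in T) #|[set x | (f g x \in F) != (x \in F) (+) c g]|)%N.
  under eq_bigr => x _ do rewrite /vote -sum1dep_card big_mkcondr /=.
  rewrite exchange_big /=; apply: eq_bigr => g _.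
  rewrite card_sum_nat; apply: eq_bigr => x _.
  by case: (_ \in F); case: (_ \in F); case: (c g).
by rewrite -sum_nat_const; apply: leq_sum => g /nearF.
Qed.

Lemma majority : (2 * m < #|V|)%N ->
  exists A : {set V},
    (forall g x, g \in T -> (f g x \in A) = (x \in A) (+) c g) /\
    (#|[set x | (x \in A) != (x \in F)]| <= 2 * m)%N.
Proof.
move=> m_small; have [x0 _] : exists x : V, x \in V by apply/card_gt0P; apply: leq_ltn_trans m_small.
have T_gt0 : (0 < #|T|)%N.
  by have [g gT _] := trT x0 x0; apply/card_gt0P; exists g.
(* By transitivity a tie at one vertex would be a tie at every vertex, and
   then [F] would be far from its translates. *)
have no_tie x : vote true x <> vote false x.
  move=> tie; have tieE y b : (2 * vote b y)%N = #|T|.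
    have [g gT <-] := trT x y; have := vote_total x; rewrite vote_act //.
    by case: (b (+) c g); rewrite tie => <-; rewrite mul2n -addnn.
  have := sum_minority.
  have : (2 * \sum_x vote (x \notin F) x = #|V| * #|T|)%N.
    rewrite big_distrr /=; under eq_bigr => y _ do rewrite tieE.
    by rewrite sum_nat_const.
  by nia.
exists [set x | vote false x < vote true x]%N; split=> [g x gT|].
  rewrite !inE !vote_act //; have := no_tie x.
  by case: (c g) => /=; rewrite ?addbF ?addbT; lia.
(* Wherever the majority overrules [F], at least half of [T] votes against [F]. *)
have : (#|T| * #|[set x | ((x \in [set x | (vote false x < vote true x)%N]) != (x \in F))]|
   <= 2 * \sum_x vote (x \notin F) x)%N.
  rewrite card_sum_nat !big_distrr /=; apply: leq_sum => x _; rewrite inE.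
  by have := vote_total x; case: (x \in F) => /=; case: ltnP => /=; lia.
by have := sum_minority; nia.
Qed.

End Majority.

(** * Edges violating [x \in A <-> y \in B] *)

Section Disagreement.
Variables (V : finType) (M : adjacency V).
Implicit Types A B F Z : {set V}.

Definition disagreement A B : nat :=
  (\sum_x \sum_y M x y * ((x \in A) != (y \in B)))%N.

Lemma edgesE A B :
  edges M A B = (\sum_x \sum_y M x y * ((x \in A) && (y \in B)))%N.
Proof.
rewrite /edges big_mkcond /=; apply: eq_bigr => x _.
case: (x \in A) => /=; last by rewrite big1 // => y _; rewrite muln0.
by rewrite big_mkcond; apply: eq_bigr => y _; case: (y \in B); rewrite ?muln1 ?muln0.
Qed.

Lemma edges_compl_boundary Z : undirected M -> edges M (~: Z) (~: ~: Z) = edges M Z (~: Z).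
Proof.
move=> symM; rewrite !edgesE exchange_big; apply: eq_bigr => x _.
by apply: eq_bigr => y _; rewrite symM setCK andbC.
Qed.

(* Up to the disagreeing edges, [A :&: B] and its counterpart are unions of
   components: an edge leaving either of them disagrees in one direction. *)
Lemma boundary_disagreement A B : undirected M ->
  (edges M (A :&: B) (~: (A :&: B)) + edges M (~: A :&: ~: B) (~: (~: A :&: ~: B))
    <= disagreement A B)%N.
Proof.
move=> symM; rewrite !edgesE /disagreement.
(* Pairing each edge with its reverse reduces the claim to a check on single pairs of vertices. *)
have double (u : V -> V -> nat) :
    (2 * (\sum_x \sum_y M x y * u x y) = \sum_x \sum_y M x y * (u x y + u y x))%N.
  rewrite mul2n -addnn {2}exchange_big -big_split /=; apply: eq_bigr => x _.
  by rewrite -big_split /=; apply: eq_bigr => y _; rewrite (symM y x) mulnDr.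
rewrite -(leq_pmul2l (isT : 0 < 2)%N) mulnDr !double -big_split /=.
apply: leq_sum => x _; rewrite -big_split /=; apply: leq_sum => y _.
rewrite -mulnDr leq_mul2l !inE; apply/orP; right.
by case: (x \in A); case: (x \in B); case: (y \in A); case: (y \in B).
Qed.

Lemma disagreement_xnor A B A' B' :
  (disagreement [set x | (x \in A) == (x \in A')] [set x | (x \in B) == (x \in B')]
    <= disagreement A B + disagreement A' B')%N.
Proof.
rewrite -big_split; apply: leq_sum => x _; rewrite -big_split.
apply: leq_sum => y _ /=; rewrite -mulnDr leq_mul2l !inE; apply/orP; right.
by case: (x \in A); case: (x \in A'); case: (y \in B); case: (y \in B').
Qed.

Lemma disagreement_tf (g : {perm V} * {perm V}) A B : tf_automorphism M g ->
  disagreement [set x | g.1 x \in A] [set x | g.2 x \in B] = disagreement A B.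
Proof.
move=> /tf_automorphismP tfg; rewrite /disagreement [RHS](reindex_inj (@perm_inj _ g.1)).
apply: eq_bigr => x _; rewrite [RHS](reindex_inj (@perm_inj _ g.2)).
by apply: eq_bigr => y _; rewrite tfg !inE.
Qed.

Lemma disagreement_perturb A B A' B' D : undirected M -> regular M D ->
  (disagreement A B <= disagreement A' B' +
     D * (#|[set x | (x \in A) != (x \in A')]| + #|[set x | (x \in B) != (x \in B')]|))%N.
Proof.
move=> symM regM; rewrite mulnDr !card_sum_nat !big_distrr /=.
have -> : (\sum_x D * ((x \in A) != (x \in A')) =
           \sum_x \sum_y M x y * ((x \in A) != (x \in A')))%N.
  by apply: eq_bigr => x _; rewrite -big_distrl regM.
have -> : (\sum_y D * ((y \in B) != (y \in B')) =
           \sum_x \sum_y M x y * ((y \in B) != (y \in B')))%N.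
  rewrite exchange_big; apply: eq_bigr => x _; rewrite -big_distrl -(regM x).
  by congr muln; apply: eq_bigr => y _.
rewrite -!big_split; apply: leq_sum => x _; rewrite -!big_split.
apply: leq_sum => y _ /=; rewrite -!mulnDr leq_mul2l; apply/orP; right.
by case: (x \in A); case: (x \in A'); case: (y \in B); case: (y \in B').
Qed.

(** Counted by their midpoint [z], the two-step walks leaving [F] number [g z * g' z]. The majority
    set [B] makes [z] contribute the smaller factor to the disagreement, and the larger factor is at
    least [D / 2]. *)
Lemma square_disagreement F D : undirected M -> regular M D ->
  exists B, (D * disagreement F B <= 2 * edges (square M) F (~: F))%N.
Proof.
move=> symM regM.
pose g z := (\sum_(a in F) M z a)%N; pose g' z := (\sum_(a in ~: F) M z a)%N.
have gg' z : (g z + g' z = D)%N.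
  rewrite -(regM z) (bigID (mem F)) /=; congr addn.
  by apply: eq_bigl => a; rewrite inE.
exists [set z | g' z < g z]%N.
have -> : disagreement F [set z | (g' z < g z)%N] = (\sum_z minn (g z) (g' z))%N.
  rewrite /disagreement exchange_big; apply: eq_bigr => z _.
  have -> : minn (g z) (g' z) = (if (g' z < g z)%N then g' z else g z).
    by rewrite minnC /minn.
  rewrite /g /g' inE; case: ifP => zB; rewrite [RHS]big_mkcond; apply: eq_bigr => a _;
    by rewrite ?inE symM; case: (a \in F); rewrite ?muln0 ?muln1.
have -> : edges (square M) F (~: F) = (\sum_z g z * g' z)%N.
  rewrite /edges /square; under eq_bigr => a _ do rewrite exchange_big.
  rewrite exchange_big; apply: eq_bigr => z _; rewrite /g big_distrl.
  by apply: eq_bigr => a _; rewrite big_distrr /=; apply: eq_bigr => b _; rewrite (symM a).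
rewrite !big_distrr; apply: leq_sum => z _; rewrite -(gg' z) /minn.
by case: ltnP => le /=; nia.
Qed.

End Disagreement.

(** * Rigidity of nearly agreeing pairs under isoperimetry *)

Section Expansion.
Variables (V : finType) (M : adjacency V) (d : nat) (h : rat).
Hypothesis symM : undirected M.
Hypothesis regM : regular M d.
Hypothesis d_gt0 : (0 < d)%N.
Hypothesis h_gt0 : 0 < h.
Hypothesis h_le1 : h <= 1.
Hypothesis isoperimetry : forall Z : {set V}, (2 * #|Z| <= #|V|)%N ->
  h * (d * #|Z|)%:R <= (edges M Z (~: Z))%:R.
Implicit Types A B Z : {set V}.

(** One factor [h] cancels against the isoperimetric inequality; the other is bounded by 1. *)
Lemma cut_size (k z t a : nat) :
  h * (d * z)%:R <= t%:R -> k%:R * t%:R <= h ^+ 2 * a%:R -> (k * (d * z) <= a)%N.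
Proof.
move=> iso small; rewrite -(ler_nat rat) natrM.
have : k%:R * (h * (d * z)%:R) <= h ^+ 2 * a%:R.
  by apply: le_trans small; rewrite ler_wpM2l ?ler0n.
rewrite mulrCA expr2 -mulrA ler_pM2l // => /le_trans; apply.
by rewrite ler_piMl ?ler0n.
Qed.

Lemma card_agreement A B :
  #|[set x | (x \in A) == (x \in B)]| = (#|A :&: B| + #|~: A :&: ~: B|)%N.
Proof.
rewrite -(cardsID A); congr addn; apply: eq_card => x; rewrite !inE;
  by case: (x \in A); case: (x \in B).
Qed.

Lemma boundary_split_size A B : (2 * #|A :&: B| <= #|V|)%N ->
    (2 * #|~: A :&: ~: B| <= #|V|)%N ->
  h * (d * #|[set x | (x \in A) == (x \in B)]|)%:R <= (disagreement M A B)%:R.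
Proof.
move=> small1 small2; rewrite card_agreement mulnDr natrD mulrDr.
apply: le_trans (lerD (isoperimetry small1) (isoperimetry small2)) _.
by rewrite -natrD ler_nat boundary_disagreement.
Qed.

(* The complement of a set has the same boundary. *)
Lemma cocut_size Z : (#|V| < 2 * #|Z|)%N ->
  h * (d * #|~: Z|)%:R <= (edges M Z (~: Z))%:R.
Proof.
move=> large; rewrite -(edges_compl_boundary Z symM); apply: isoperimetry.
by have := cardsC Z; lia.
Qed.

Lemma agreement_small A B : (0 < #|A|)%N -> (2 * #|A| <= #|V|)%N ->
    24%:R * (disagreement M A B)%:R <= h ^+ 2 * #|A|%:R ->
  (24 * (d * #|[set x | (x \in A) == (x \in B)]|) <= #|A|)%N.
Proof.
move=> A_gt0 A_half small; have bd := boundary_disagreement A B symM.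
have AB := subset_leq_card (subsetIl A B).
have [co|co] := leqP (2 * #|~: A :&: ~: B|)%N #|V|.
  apply: (cut_size (k := 24) _ small); apply: boundary_split_size co.
  by apply: leq_trans A_half; rewrite leq_mul2l AB.
(* Were the common complement more than half of [V], isoperimetry would make [A :|: B] smaller than
   its subset [A]. *)
have : (24 * (d * #|~: (~: A :&: ~: B)|) <= #|A|)%N.
  apply: (cut_size (k := 24) _ small); apply: le_trans (cocut_size co) _.
  by rewrite ler_nat; apply: leq_trans (leq_addl _ _) bd.
have := subset_leq_card (subsetUl A B).
by rewrite setCI !setCK; nia.
Qed.

Lemma translate_near (g : {perm V} * {perm V}) A B : tf_automorphism M g ->
    (0 < #|A|)%N -> (2 * #|A| <= #|V|)%N ->
    24%:R * (disagreement M A B)%:R <= h ^+ 2 * #|A|%:R ->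
  exists b : bool,
    (12 * d * #|[set x | (g.1 x \in A) != (x \in A) (+) b]| <= #|A|)%N /\
    (12 * d * #|[set x | (g.2 x \in B) != (x \in B) (+) b]| <= #|A|)%N.
Proof.
move=> tfg A_gt0 A_half small.
pose A' := [set x | g.1 x \in A]; pose B' := [set x | g.2 x \in B].
have disA'B' : disagreement M A' B' = disagreement M A B by apply: disagreement_tf.
have cardA' : #|A'| = #|A| by rewrite card_preim_perm; apply: eq_card => x; rewrite inE.
(* [X] and [Y] record where the translate agrees with the original. If [X :&: Y] or [~: X :&: ~: Y]
   exceeds half of [V], its complement is small, which gives [b]. *)
pose X := [set x | (x \in A') == (x \in A)]; pose Y := [set x | (x \in B') == (x \in B)].
have disXY : (disagreement M X Y <= 2 * disagreement M A B)%N.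
  by have := disagreement_xnor M A' B' A B; rewrite disA'B' addnn -mul2n.
have smallXY : 12%:R * (disagreement M X Y)%:R <= h ^+ 2 * #|A|%:R.
  apply: le_trans small; rewrite -!natrM ler_nat; lia.
have bd := boundary_disagreement X Y symM.
have close Z : (edges M Z (~: Z) <= disagreement M X Y)%N -> (#|V| < 2 * #|Z|)%N ->
    (12 * d * #|~: Z| <= #|A|)%N.
  move=> bdZ large; rewrite -mulnA; apply: (cut_size (k := 12) _ smallXY).
  by apply: le_trans (cocut_size large) _; rewrite ler_nat.
have mono (P Z : {set V}) : {subset P <= ~: Z} -> (12 * d * #|~: Z| <= #|A|)%N ->
    (12 * d * #|P| <= #|A|)%N.
  move=> sub; apply: leq_trans; rewrite leq_mul2l; apply/orP; right.
  by apply: subset_leq_card; apply/subsetP.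
have [le1|gt1] := leqP (2 * #|X :&: Y|)%N #|V|; last first.
  exists false; split; apply: (mono _ (X :&: Y)); try by apply: close => //; lia.
    by move=> x; rewrite !inE addbF => /negPf ->.
  by move=> x; rewrite !inE addbF => /negPf ->; rewrite andbF.
have [le2|gt2] := leqP (2 * #|~: X :&: ~: Y|)%N #|V|; last first.
  exists true; split; apply: (mono _ (~: X :&: ~: Y)); try by apply: close => //; lia.
    by move=> x; rewrite !inE; case: (_ \in A); case: (_ \in A).
  by move=> x; rewrite !inE andbC; case: (_ \in B); case: (_ \in B).
have : (12 * (d * #|[set x | (x \in X) == (x \in Y)]|) <= #|A|)%N.
  by apply: (cut_size (k := 12) _ smallXY); apply: boundary_split_size.
have := agreement_small A_gt0 A_half small.
have : (24 * (d * #|[set x | (x \in A') == (x \in B')]|) <= #|A|)%N.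
  by rewrite -cardA'; apply: agreement_small; rewrite ?cardA' ?disA'B'.
(* In the remaining case three sets, of total size at most [(1/12 + 1/24 + 1/24) * #|A|], would
   cover [V] by parity. *)
have : (#|V| <= #|[set x | (x \in X) == (x \in Y)]| +
    (#|[set x | (x \in A) == (x \in B)]| + #|[set x | (x \in A') == (x \in B')]|))%N.
  rewrite !card_sum_nat -!big_split -sum1_card; apply: leq_sum => x _ /=.
  by rewrite !inE; do 2!case: (_ \in A); do 2!case: (_ \in B).
by nia.
Qed.

Hypothesis trM : tf_transitive M.

(** Both memberships flip together, so every vertex contributes the same number of violating edges
    as [x0]. *)
Lemma disagreement_tf_const A B (c : {perm V} * {perm V} -> bool) :
    (forall g x, tf_automorphism M g -> (g.1 x \in A) = (x \in A) (+) c g) ->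
    (forall g x, tf_automorphism M g -> (g.2 x \in B) = (x \in B) (+) c g) ->
  exists r, disagreement M A B = (#|V| * r)%N.
Proof.
move=> actA actB; have [noV | [x0 _]] := set_0Vmem [set: V].
  exists 0%N; rewrite muln0 /disagreement big1 // => x.
  by have := in_setT x; rewrite noV inE.
exists (\sum_y M x0 y * ((x0 \in A) != (y \in B)))%N.
rewrite /disagreement -sum_nat_const; apply: eq_bigr => x _.
have [g tfg <-] := trM x0 x; rewrite (reindex_inj (@perm_inj _ g.2)).
apply: eq_bigr => y _; rewrite actA // actB // (tf_automorphismP _ _ tfg).
by case: (_ \in A); case: (_ \in B); case: (c g).
Qed.

Lemma exact_pair A B : (0 < #|A|)%N -> (2 * #|A| <= #|V|)%N ->
    24%:R * (disagreement M A B)%:R <= h ^+ 2 * #|A|%:R ->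
  exists A' B' : {set V}, disagreement M A' B' = 0%N /\
    exists x, (x \in A') != (x \in B').
Proof.
move=> A_gt0 A_half small; pose m := (#|A| %/ (12 * d))%N.
pose near (g : {perm V} * {perm V}) (b : bool) :=
    (#|[set x | (g.1 x \in A) != (x \in A) (+) b]| <= m)%N &&
    (#|[set x | (g.2 x \in B) != (x \in B) (+) b]| <= m)%N.
have m_small : (12 * d * m <= #|A|)%N by rewrite mulnC leq_divM.
have m_le : (12 * m <= #|A|)%N.
  by apply: leq_trans m_small; rewrite leq_mul2r leq_pmulr ?orbT.
have leq_m k : (k <= m)%N = (12 * d * k <= #|A|)%N.
  by rewrite leq_divRL ?muln_gt0 ?d_gt0 // mulnC.
pose c g := ~~ near g false.
pose T := [set g | tf_automorphism M g].
have near_c g : g \in T -> near g (c g).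
  rewrite inE => tfg; rewrite /c; case: (boolP (near g false)) => // far.
  have [[] []] := translate_near tfg A_gt0 A_half small.
    by move=> gA gB; rewrite /near !leq_m gA gB.
  by move=> gA gB; move: far; rewrite /near !leq_m gA gB.
have TM g k : g \in T -> k \in T -> (g * k)%g \in T.
  by rewrite !inE; apply: tf_automorphismM.
have cM g k : g \in T -> k \in T -> c (g * k)%g = c g (+) c k.
  move=> gT kT; have /andP[gkA _] := near_c _ (TM _ _ gT kT).
  have /andP[gA _] := near_c _ gT; have /andP[kA _] := near_c _ kT.
  apply/eqP; apply: contraT => cN.
  (* If [c] failed to be multiplicative at [g], [k], every vertex would be exceptional for [g], [k]
     or [g * k], forcing [#|V| <= 3 * m]. *)
  have : (#|V| <= #|[set x | ((g * k)%g.1 x \in A) != (x \in A) (+) c (g * k)%g]| +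
     (#|[set x | (g.1 x \in A) != (x \in A) (+) c g]| +
      #|[set x | (k.1 (g.1 x) \in A) != (g.1 x \in A) (+) c k]|))%N.
    rewrite !card_sum_nat -!big_split -sum1_card; apply: leq_sum => x _ /=.
    rewrite permM; move: cN; case: (c _); case: (c g); case: (c k) => //=;
      by do 3!case: (_ \in A).
  rewrite (card_preim_perm g.1 (fun x => (k.1 x \in A) != (x \in A) (+) c k)).
  by move/leq_trans/(_ (leq_add gkA (leq_add gA kA))); lia.
have [A' [actA' nearA']] : exists A' : {set V},
    (forall g x, g \in T -> (g.1 x \in A') = (x \in A') (+) c g) /\
    (#|[set x | (x \in A') != (x \in A)]| <= 2 * m)%N.
  apply: (@majority V _ T fst c) => //; last by nia.
    by move=> x y; have [g tfg gxy] := trM x y; exists g; rewrite ?inE.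
  by move=> g /near_c/andP[].
have [B' [actB' nearB']] : exists B' : {set V},
    (forall g x, g \in T -> (g.2 x \in B') = (x \in B') (+) c g) /\
    (#|[set x | (x \in B') != (x \in B)]| <= 2 * m)%N.
  apply: (@majority V _ T snd c) => //; last by nia.
    (* Swapping components transfers transitivity to the second one. *)
    move=> x y; have [g tfg gxy] := trM x y; exists (g.2, g.1) => //.
    by rewrite inE tf_automorphism_swap.
  by move=> g /near_c/andP[].
exists A', B'; split.
  have [r disr] : exists r, disagreement M A' B' = (#|V| * r)%N.
    by apply: (@disagreement_tf_const _ _ c) => g x tfg; [apply: actA' | apply: actB'];
      rewrite inE.
  (* The disagreement is at most [#|A| / 24 + 4 * d * m], and [4 * d * m <= #|A| / 3], so it is
     below [#|V|]. *)
  have := disagreement_perturb A' B' A B symM regM.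
  have : (24 * disagreement M A B <= #|A|)%N.
    rewrite -(ler_nat rat) natrM; apply: le_trans small _.
    by rewrite ler_piMl ?ler0n // expr_le1 // ltW.
  by rewrite disr; case: r {disr} => [|r]; rewrite ?muln0 //; nia.
(* If [A' = B'], then [V] is covered by the agreement set of [A] and [B] and the two sets of changed
   vertices, again too few. *)
apply/existsP; apply: contraT; rewrite negb_exists => /forallP eqAB.
have := agreement_small A_gt0 A_half small.
have : (#|V| <= #|[set x | (x \in A) == (x \in B)]| +
    (#|[set x | (x \in A') != (x \in A)]| + #|[set x | (x \in B') != (x \in B)]|))%N.
  rewrite !card_sum_nat -!big_split -sum1_card; apply: leq_sum => x _ /=.
  move: (eqAB x); rewrite negbK => /eqP ->.
  by case: (_ \in A); case: (_ \in B); case: (_ \in B').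
by nia.
Qed.

End Expansion.

(** * Consequences of connectedness, and bounds on the Cheeger constant *)

Lemma connected_invariant (V : finType) (M : adjacency V) (P : pred V) :
  connected M -> (forall x y, (0 < M x y)%N -> P x = P y) -> forall x y, P x = P y.
Proof.
move=> conM step x y; have /connectP[p] := conM x y.
elim: p x => [x _ -> // | z p IHp x /= /andP[xz zp] yE].
by rewrite (step x z xz); apply: IHp.
Qed.

(** Each edge, read in both directions, exchanges membership in [A] and in [B], so whether the two
    differ is constant along edges. *)
Lemma disagreement0_bipartite (V : finType) (M : adjacency V) (A B : {set V}) x0 :
  undirected M -> connected M -> disagreement M A B = 0%N ->
  (x0 \in A) != (x0 \in B) -> bipartite M.
Proof.
move=> symM conM dis0 x0AB.
have edge x y : (0 < M x y)%N -> (x \in A) = (y \in B).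
  move=> xy; apply/eqP; apply: contraT => neq.
  move/eqP: dis0; rewrite sum_nat_eq0 => /forallP/(_ x)/=.
  rewrite sum_nat_eq0 => /forallP/(_ y)/=; rewrite neq muln1 => /eqP xy0.
  by rewrite xy0 in xy.
have inv u v : (0 < M u v)%N -> ((u \in A) != (u \in B)) = ((v \in A) != (v \in B)).
  move=> uv; have vu : (0 < M v u)%N by rewrite symM.
  by rewrite (edge _ _ uv) -(edge _ _ vu) eq_sym.
have AB x : (x \in A) != (x \in B).
  by have /= -> := connected_invariant (P := fun z => (z \in A) != (z \in B)) conM inv x x0.
exists A => x y; case: (posnP (M x y)) => // xy xyA.
by have := AB y; rewrite -(edge _ _ xy) xyA eqxx.
Qed.

(** A minimizer without boundary would be closed under adjacency, hence all of [V]. *)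
Lemma cheeger_gt0 (V : finType) (M : adjacency V) (d : nat) :
  (1 < #|V|)%N -> (0 < d)%N -> connected M -> 0 < cheeger M d.
Proof.
move=> V_gt1 d_gt0 conM; have [[F /andP[F0 Fhalf] ->] _] := cheegerP M d V_gt1.
rewrite /cheeger_ratio divr_gt0 ?mulr_gt0 ?ltr0n ?card_gt0 // lt0n.
apply/eqP=> e0; have /set0Pn[x xF] := F0.
have stay u v : (0 < M u v)%N -> (u \in F) -> (v \in F).
  move=> uv uF; apply: contraT => vF; move/eqP: e0.
  rewrite edgesE sum_nat_eq0 => /forallP/(_ u)/=.
  rewrite sum_nat_eq0 => /forallP/(_ v)/=; rewrite uF inE vF muln1.
  by move/eqP=> uv0; rewrite uv0 in uv.
have FT : F = [set: V].
  apply/setP=> y; rewrite inE; have /connectP[p] := conM x y.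
  elim: p x xF => [x xF _ -> // | z p IHp x xF /= /andP[xz zp] lastz].
  by apply: (IHp z) => //; apply: stay xz xF.
by move: Fhalf; rewrite FT cardsT; lia.
Qed.

Lemma cheeger_le1 (V : finType) (M : adjacency V) (d : nat) :
  (1 < #|V|)%N -> regular M d -> cheeger M d <= 1.
Proof.
move=> V_gt1 regM; have [x _] : exists x : V, x \in V by apply/card_gt0P; apply: ltnW.
have [_ /(_ [set x])] := cheegerP M d V_gt1.
have -> : cheeger_admissible [set x].
  by rewrite /cheeger_admissible /= cards1 -card_gt0 cards1.
move=> /(_ isT) /le_trans; apply; rewrite /cheeger_ratio cards1 mulr1.
have [->|d_gt0] := posnP d; first by rewrite invr0 mulr0.
rewrite ler_pdivrMr ?ltr0n // mul1r ler_nat /edges big_set1 -(regM x) big_mkcond.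
by apply: leq_sum => y _; case: ifP.
Qed.

Lemma cheeger_isoperimetry (V : finType) (M : adjacency V) (d : nat) (Z : {set V}) :
  (1 < #|V|)%N -> (0 < d)%N -> (2 * #|Z| <= #|V|)%N ->
  cheeger M d * (d * #|Z|)%:R <= (edges M Z (~: Z))%:R.
Proof.
move=> V_gt1 d_gt0 Z_half; have [->|Z0] := eqVneq Z set0.
  by rewrite cards0 muln0 mulr0 ler0n.
have [_ /(_ Z)] := cheegerP M d V_gt1; rewrite /cheeger_admissible /= Z0 => /(_ Z_half).
by rewrite /cheeger_ratio natrM ler_pdivlMr ?mulr_gt0 ?ltr0n ?card_gt0.
Qed.

Theorem theorem1p3 (V : finType) (M : adjacency V) (d : nat) :
  (1 < #|V|)%N ->
  is_cayley_graph M \/ is_cayley_sum_graph M \/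
  is_twisted_cayley_graph M \/ is_twisted_cayley_sum_graph M \/
  vertex_transitive M ->
  regular M d ->
  undirected M ->
  connected M ->
  ~ bipartite M ->
  cheeger M d ^+ 2 / (48%:R * d%:R) < cheeger (square M) (d ^ 2).
Proof.
move=> V_gt1 classM regM symM conM nbipM.
have trM : tf_transitive M.
  case: classM => [[gT [S]]|[[gT [S]]|[[gT [S [s [sA]]]]|[[gT [S [s [sA]]]]|]]]].
  - by move/graph_iso_tf_transitive; apply; apply: twisted_cayley_tf_transitive.
  - by move/graph_iso_tf_transitive; apply; apply: twisted_cayley_sum_tf_transitive.
  - by move/graph_iso_tf_transitive; apply; apply: twisted_cayley_tf_transitive.
  - by move/graph_iso_tf_transitive; apply; apply: twisted_cayley_sum_tf_transitive.
  - exact: vertex_transitive_tf_transitive.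
have d_gt0 : (0 < d)%N.
  rewrite lt0n; apply/eqP=> d0; apply: nbipM; exists set0 => x y _.
  by have /eqP := regM x; rewrite d0 sum_nat_eq0 => /forallP/(_ y)/eqP.
rewrite ltNge; apply/negP=> small; apply: nbipM.
have [[F /andP[F0 Fhalf] chF] _] := cheegerP (square M) (d ^ 2) V_gt1.
have F_gt0 : (0 < #|F|)%N by rewrite card_gt0.
have [B disB] := square_disagreement F symM regM.
(* The constant 48 is 24 times the factor 2 lost in [square_disagreement]. *)
have smallFB : 24%:R * (disagreement M F B)%:R <= cheeger M d ^+ 2 * #|F|%:R.
  have dR : 0 < d%:R :> rat by rewrite ltr0n.
  have d2R : 0 < (d ^ 2)%N%:R :> rat by rewrite ltr0n expn_gt0 d_gt0.
  have fR : 0 < #|F|%:R :> rat by rewrite ltr0n.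
  have d48R : 0 < 48%:R * d%:R :> rat by rewrite mulr_gt0 // ltr0n.
  move: small; rewrite chF /cheeger_ratio (ler_pdivlMr _ _ d48R).
  rewrite mulrAC (ler_pdivrMr _ _ (mulr_gt0 d2R fR)) => small.
  move: disB; rewrite -(ler_nat rat) !natrM => disB; move: small; rewrite natrX.
  set e := _%:R; set D := (disagreement _ _ _)%:R in disB *; set f := #|F|%:R.
  move=> small; rewrite -(ler_pM2l dR) -(ler_pM2l dR).
  have : d%:R * (d%:R * D) <= d%:R * (2 * e) by rewrite ler_pM2l.
  by nra.
have [A' [B' [dis0 [x xAB]]]] := exact_pair symM regM d_gt0
  (cheeger_gt0 V_gt1 d_gt0 conM) (cheeger_le1 V_gt1 regM)
  (fun Z => @cheeger_isoperimetry V M d Z V_gt1 d_gt0) trM F_gt0 Fhalf smallFB.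
exact: disagreement0_bipartite dis0 xAB.
Qed.
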